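(* The variety $\mathcal{V}_{\sigma\mathbb{RS}_u}$ is generated by $\mathbb{R}$: every $G\in\mathcal{V}_{\sigma\mathbb{RS}_u}$ is isomorphic to a subalgebra of a quotient of a power of the algebra $\mathbb{R}$ with its usual Riesz space operations, $\bigvee^-(g,f_1,f_2,\dots)=\sup_{n\ge1}\{f_n\wedge g\}$, and the constant $1$ interpreted as the real number $1$.
   Context: $\mathcal{V}_{\sigma\mathbb{RS}_u}$ is the infinitary variety of algebras with the Riesz space operations ($0,+,-,\vee,\wedge$, $\lambda\cdot-$ for $\lambda\in\mathbb{R}$), a countably infinitary operation $\bigvee^-$ (write $\bigvee_{n\ge1}^g f_n:=\bigvee^-(g,f_1,f_2,\dots)$) and a constant $1$, satisfying the Riesz space axioms, (A1) $\bigvee_{n\ge1}^g f_n=\bigvee_{n\ge1}^g(f_n\wedge g)$; (A2) $\bigvee_{n\ge1}^g f_n=(f_1\wedge g)\vee\bigvee^-(g,f_2,f_3,\dots)$; (A3) $\bigvee_{n\ge1}^g(f_n\wedge h)\le h$ ($a\le b$ meaning $a\wedge b=a$); and $\bigvee_{n\ge1}^{|f|}(|f|\wedge n1)=|f|$. *)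

(* Defs.v *)
From Stdlib Require Import Reals.
Open Scope R_scope.

(** Signature of V_{sigma RS_u}: 0, +, - (unary negation), meet, join,
    scalar multiplication by each real, the countably infinitary
    operation bigv g (f_1, f_2, ...) and the constant 1.
    A sequence f_1, f_2, ... is represented by F : nat -> A with
    F k = f_(k+1). *)
Record sig_alg := SigAlg {
  car   :> Type;
  zero  : car;
  add   : car -> car -> car;
  opp   : car -> car;
  meet  : car -> car -> car;
  join  : car -> car -> car;
  smul  : R -> car -> car;
  bigv  : car -> (nat -> car) -> car;
  one   : car
}.

Arguments zero {s}. Arguments add {s}. Arguments opp {s}. Arguments meet {s}.
Arguments join {s}. Arguments smul {s}. Arguments bigv {s}. Arguments one {s}.

Definition ale {A : sig_alg} (a b : A) : Prop := meet a b = a.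
Definition aabs {A : sig_alg} (a : A) : A := join a (opp a).

Definition is_riesz (A : sig_alg) : Prop :=
  (forall x y z : A, add x (add y z) = add (add x y) z) /\
  (forall x y : A, add x y = add y x) /\
  (forall x : A, add x zero = x) /\
  (forall x : A, add x (opp x) = zero) /\
  (forall (a : R) (x y : A), smul a (add x y) = add (smul a x) (smul a y)) /\
  (forall (a b : R) (x : A), smul (a + b) x = add (smul a x) (smul b x)) /\
  (forall (a b : R) (x : A), smul a (smul b x) = smul (a * b) x) /\
  (forall x : A, smul 1 x = x) /\
  (forall x y : A, meet x y = meet y x) /\
  (forall x y : A, join x y = join y x) /\
  (forall x y z : A, meet x (meet y z) = meet (meet x y) z) /\
  (forall x y z : A, join x (join y z) = join (join x y) z) /\
  (forall x y : A, meet x (join x y) = x) /\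
  (forall x y : A, join x (meet x y) = x) /\
  (forall x y z : A, ale x y -> ale (add x z) (add y z)) /\
  (forall (a : R) (x y : A), 0 <= a -> ale x y -> ale (smul a x) (smul a y)).

Definition is_sRSu (A : sig_alg) : Prop :=
  is_riesz A /\
  (forall (g : A) (F : nat -> A), bigv g F = bigv g (fun k => meet (F k) g)) /\
  (forall (g : A) (F : nat -> A),
      bigv g F = join (meet (F 0%nat) g) (bigv g (fun k => F (S k)))) /\
  (forall (g h : A) (F : nat -> A), ale (bigv g (fun k => meet (F k) h)) h) /\
  (forall f : A,
      bigv (aabs f) (fun k => meet (aabs f) (smul (INR (S k)) one)) = aabs f).

Lemma R_sup_bound (g : R) (F : nat -> R) :
  bound (fun x => exists k : nat, x = Rmin (F k) g).
Proof.
  exists g. intros x [k ->]. apply Rmin_r.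
Qed.

Lemma R_sup_ne (g : R) (F : nat -> R) :
  exists x, (fun x => exists k : nat, x = Rmin (F k) g) x.
Proof. exists (Rmin (F 0%nat) g). exists 0%nat. reflexivity. Qed.

Definition R_bigv (g : R) (F : nat -> R) : R :=
  proj1_sig (completeness _ (R_sup_bound g F) (R_sup_ne g F)).

Definition R_alg : sig_alg :=
  {| car := R; zero := 0; add := Rplus; opp := Ropp; meet := Rmin;
     join := Rmax; smul := Rmult; bigv := R_bigv; one := 1 |}.

Definition Rpow (I : Type) : sig_alg :=
  {| car := I -> R;
     zero := fun _ => 0;
     add := fun f g i => f i + g i;
     opp := fun f i => - f i;
     meet := fun f g i => Rmin (f i) (g i);
     join := fun f g i => Rmax (f i) (g i);
     smul := fun a f i => a * f i;
     bigv := fun g F i => R_bigv (g i) (fun k => F k i);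
     one := fun _ => 1 |}.

Definition is_congruence (A : sig_alg) (th : A -> A -> Prop) : Prop :=
  (forall x, th x x) /\
  (forall x y, th x y -> th y x) /\
  (forall x y z, th x y -> th y z -> th x z) /\
  (forall x x' y y', th x x' -> th y y' -> th (add x y) (add x' y')) /\
  (forall x x', th x x' -> th (opp x) (opp x')) /\
  (forall x x' y y', th x x' -> th y y' -> th (meet x y) (meet x' y')) /\
  (forall x x' y y', th x x' -> th y y' -> th (join x y) (join x' y')) /\
  (forall a x x', th x x' -> th (smul a x) (smul a x')) /\
  (forall g g' (F F' : nat -> A), th g g' -> (forall k, th (F k) (F' k)) ->
      th (bigv g F) (bigv g' F')).

(** [phi] induces an embedding (injective homomorphism) of [G] into the
    quotient [B / th], i.e. an isomorphism of [G] onto a subalgebra of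
    [B / th] (its image). *)
Definition embeds_into_quotient (G B : sig_alg) (th : B -> B -> Prop)
  (phi : G -> B) : Prop :=
  th (phi zero) zero /\
  th (phi one) one /\
  (forall x y, th (phi (add x y)) (add (phi x) (phi y))) /\
  (forall x, th (phi (opp x)) (opp (phi x))) /\
  (forall x y, th (phi (meet x y)) (meet (phi x) (phi y))) /\
  (forall x y, th (phi (join x y)) (join (phi x) (phi y))) /\
  (forall a x, th (phi (smul a x)) (smul a (phi x))) /\
  (forall g (F : nat -> G), th (phi (bigv g F)) (bigv (phi g) (fun k => phi (F k)))) /\
  (forall x y, th (phi x) (phi y) -> x = y).

(* Main.v *)
(** Loomis-Sikorski by a Rasiowa-Sikorski argument. (A1)-(A3) say that
    [bigv g F] is the supremum of the [meet (F n) g], so [G] is a Dedekind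
    sigma-complete Riesz space in which 1 is a weak unit. Take [I] to be the
    set of all functions [v : G -> R] and send [x] to evaluation at [x];
    two elements of [R^I] are identified when they agree at every [v] that
    satisfies some fixed countable set of homomorphism equations. Evaluation
    is then trivially a homomorphism modulo this congruence, and injectivity
    says: if x <= y fails, then for any countable set of homomorphism
    equations there is a [v] satisfying all of them with [v y < v x].
    Such a [v] is read off a generic decreasing sequence of nonzero
    p_k >= 0, where p forces f <= t when p /\ (f - t 1)^+ = 0: start with a p
    forcing x - y >= d > 0, and meet the countably many dense sets which
    decide the relevant elements up to 1/m and make the relevant suprema
    attained up to 1/m. *)

Require Import Defs.
From Stdlib Require Import Reals Lra Lia List FunctionalExtensionality Classical ClassicalEpsilon Cantor.

Existing Class is_riesz.
Existing Class is_sRSu.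

(** * Vector space identities, decided by comparing coefficients *)

Section Vector.

Context {G : sig_alg} {HG : is_riesz G}.

(** A reflective decision procedure for linear identities (tactic [vec]). *)
Inductive lexp := LVar (n : nat) | LZero | LAdd (a b : lexp) | LOpp (a : lexp)
  | LSmul (c : R) (a : lexp).

Fixpoint leval (env : list G) (e : lexp) : G :=
  match e with
  | LVar n => nth n env zero
  | LZero => zero
  | LAdd a b => add (leval env a) (leval env b)
  | LOpp a => opp (leval env a)
  | LSmul c a => smul c (leval env a)
  end.

Fixpoint lcoef (e : lexp) (k : nat) : R :=
  match e with
  | LVar n => if Nat.eqb n k then 1 else 0
  | LZero => 0
  | LAdd a b => lcoef a k + lcoef b k
  | LOpp a => - lcoef a k
  | LSmul c a => c * lcoef a k
  end.

Fixpoint lcomb (c : nat -> R) (env : list G) : G :=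
  match env with
  | nil => zero
  | x :: env' => add (smul (c 0%nat) x) (lcomb (fun k => c (S k)) env')
  end.

(** Coefficients are compared only along [env], so on a concrete list of atoms the condition unfolds
    to finitely many real equations. *)
Fixpoint lsame (c d : nat -> R) (env : list G) : Prop :=
  match env with
  | nil => True
  | x :: env' => c 0%nat = d 0%nat /\ lsame (fun k => c (S k)) (fun k => d (S k)) env'
  end.

Lemma addA (x y z : G) : add x (add y z) = add (add x y) z.
Proof. apply HG. Qed.
Lemma addC (x y : G) : add x y = add y x.
Proof. apply HG. Qed.
Lemma add0 (x : G) : add x zero = x.
Proof. apply HG. Qed.
Lemma addN (x : G) : add x (opp x) = zero.
Proof. apply HG. Qed.
Lemma smulD (a : R) (x y : G) : smul a (add x y) = add (smul a x) (smul a y).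
Proof. apply HG. Qed.
Lemma smulDl (a b : R) (x : G) : smul (a + b) x = add (smul a x) (smul b x).
Proof. apply HG. Qed.
Lemma smulA (a b : R) (x : G) : smul a (smul b x) = smul (a * b) x.
Proof. apply HG. Qed.
Lemma smul1 (x : G) : smul 1 x = x.
Proof. apply HG. Qed.

Lemma addIr (x y z : G) : add x z = add y z -> x = y.
Proof.
  intros E. rewrite <- (add0 x), <- (add0 y), <- (addN z), !addA, E. reflexivity.
Qed.

Lemma smul0l (x : G) : smul 0 x = zero.
Proof.
  apply (addIr _ _ (smul 0 x)). rewrite <- smulDl, (addC zero), add0.
  f_equal. ring.
Qed.

Lemma smul0r (a : R) : smul a zero = zero :> G.
Proof.
  apply (addIr _ _ (smul a zero)). rewrite <- smulD, add0, (addC zero), add0. reflexivity.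
Qed.

Lemma oppE (x : G) : opp x = smul (-1) x.
Proof.
  apply (addIr _ _ x). rewrite addC, addN. symmetry.
  transitivity (add (smul (-1) x) (smul 1 x)); [rewrite smul1; reflexivity|].
  rewrite <- smulDl. replace (-1 + 1) with 0 by ring. apply smul0l.
Qed.

Lemma lcomb_ext (env : list G) : forall c d : nat -> R, lsame c d env -> lcomb c env = lcomb d env.
Proof.
  induction env as [|x env IH]; simpl; intros c d E; [reflexivity|].
  destruct E as [E1 E2]. rewrite E1. f_equal. apply IH, E2.
Qed.

Lemma lcomb0 (env : list G) : lcomb (fun _ => 0) env = zero.
Proof.
  induction env as [|x env IH]; simpl; [reflexivity|].
  rewrite IH, add0, smul0l. reflexivity.
Qed.

Lemma lcombD (env : list G) : forall c d,
  lcomb (fun k => c k + d k) env = add (lcomb c env) (lcomb d env).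
Proof.
  induction env as [|x env IH]; simpl; intros c d; [symmetry; apply add0|].
  rewrite IH, smulDl, !addA. f_equal. rewrite <- !addA. f_equal. apply addC.
Qed.

Lemma lcombZ (env : list G) : forall a c,
  lcomb (fun k => a * c k) env = smul a (lcomb c env).
Proof.
  induction env as [|x env IH]; simpl; intros a c; [symmetry; apply smul0r|].
  rewrite IH, smulD, smulA. reflexivity.
Qed.

Lemma lcomb_var (env : list G) : forall n,
  lcomb (fun k => if Nat.eqb n k then 1 else 0) env = nth n env zero.
Proof.
  induction env as [|x env IH]; intros [|n]; simpl; try reflexivity.
  - rewrite lcomb0, add0, smul1. reflexivity.
  - rewrite IH, smul0l, addC, add0. reflexivity.
Qed.

Lemma lsame_refl (env : list G) : forall c d, (forall k, c k = d k) -> lsame c d env.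
Proof. induction env; simpl; auto. Qed.

Lemma leval_lcomb (env : list G) (e : lexp) : leval env e = lcomb (lcoef e) env.
Proof.
  induction e; simpl.
  - symmetry; apply lcomb_var.
  - symmetry; apply lcomb0.
  - rewrite lcombD; congruence.
  - rewrite IHe, oppE, <- lcombZ. apply lcomb_ext, lsame_refl. intros k; ring.
  - rewrite lcombZ; congruence.
Qed.

Lemma leval_eq (env : list G) (a b : lexp) :
  lsame (lcoef a) (lcoef b) env -> leval env a = leval env b.
Proof. rewrite !leval_lcomb. apply lcomb_ext. Qed.

End Vector.

Ltac lmem x l :=
  match l with
  | nil => constr:(false)
  | x :: _ => constr:(true)
  | _ :: ?l' => lmem x l'
  end.
Ltac lsnoc x l :=
  match l with
  | @nil ?T => constr:(@cons T x (@nil T))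
  | @cons ?T ?y ?l' => let r := lsnoc x l' in constr:(@cons T y r)
  end.
Ltac lindex x l :=
  match l with
  | x :: _ => constr:(O)
  | _ :: ?l' => let n := lindex x l' in constr:(S n)
  end.
Ltac latoms e l :=
  match e with
  | add ?a ?b => let l1 := latoms a l in latoms b l1
  | opp ?a => latoms a l
  | smul _ ?a => latoms a l
  | zero => l
  | _ => match lmem e l with true => l | false => lsnoc e l end
  end.
Ltac lquote e l :=
  match e with
  | add ?a ?b => let a' := lquote a l in let b' := lquote b l in constr:(LAdd a' b')
  | opp ?a => let a' := lquote a l in constr:(LOpp a')
  | smul ?c ?a => let a' := lquote a l in constr:(LSmul c a')
  | zero => constr:(LZero)
  | _ => let n := lindex e l in constr:(LVar n)
  end.
(** Coefficient equations that [ring] cannot close, such as those with inverses, are left as goals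
    to the caller. *)
Ltac vec :=
  match goal with
  | |- @eq (car ?G) ?a ?b =>
      let l0 := latoms a (@nil (car G)) in
      let l := latoms b l0 in
      let a' := lquote a l in
      let b' := lquote b l in
      apply (leval_eq l a' b'); cbn [lsame lcoef Nat.eqb];
      repeat split; try ring
  end.

(** * Lattice order and its compatibility with the linear structure *)

Section Riesz.

Context {G : sig_alg} {HG : is_riesz G}.
Implicit Types (p q u v w x y z f g h : G) (a b c s t : R).

Lemma meetC x y : meet x y = meet y x.
Proof. apply HG. Qed.
Lemma joinC x y : join x y = join y x.
Proof. apply HG. Qed.
Lemma meetA x y z : meet x (meet y z) = meet (meet x y) z.
Proof. apply HG. Qed.
Lemma joinA x y z : join x (join y z) = join (join x y) z.
Proof. apply HG. Qed.
Lemma meetKU x y : meet x (join x y) = x.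
Proof. apply HG. Qed.
Lemma joinKI x y : join x (meet x y) = x.
Proof. apply HG. Qed.
Lemma ale_add x y z : ale x y -> ale (add x z) (add y z).
Proof. apply HG. Qed.
Lemma ale_smul a x y : 0 <= a -> ale x y -> ale (smul a x) (smul a y).
Proof. apply HG. Qed.

Lemma meetxx x : meet x x = x.
Proof. rewrite <- (joinKI x x) at 2. apply meetKU. Qed.

Lemma ale_refl x : ale x x.
Proof. apply meetxx. Qed.

Lemma ale_trans y x z : ale x y -> ale y z -> ale x z.
Proof. unfold ale. intros E1 E2. rewrite <- E1, <- meetA, E2. reflexivity. Qed.

Lemma ale_anti x y : ale x y -> ale y x -> x = y.
Proof. unfold ale. intros E1 E2. rewrite <- E1, meetC. exact E2. Qed.

Lemma meet_l x y : ale (meet x y) x.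
Proof. unfold ale. rewrite meetC, meetA, meetxx. reflexivity. Qed.

Lemma meet_r x y : ale (meet x y) y.
Proof. rewrite meetC. apply meet_l. Qed.

Lemma meet_glb x y z : ale z x -> ale z y -> ale z (meet x y).
Proof. unfold ale. intros E1 E2. rewrite meetA, E1. exact E2. Qed.

Lemma join_l x y : ale x (join x y).
Proof. apply meetKU. Qed.

Lemma join_r x y : ale y (join x y).
Proof. rewrite joinC. apply meetKU. Qed.

Lemma ale_join x y : ale x y <-> join x y = y.
Proof.
  unfold ale; split; intros E.
  - rewrite <- E, joinC, meetC. apply joinKI.
  - rewrite <- E. apply meetKU.
Qed.

Lemma join_lub x y z : ale x z -> ale y z -> ale (join x y) z.
Proof.
  rewrite !ale_join. intros E1 E2. rewrite <- joinA, E2. exact E1.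
Qed.

Lemma ale_sub x y : ale zero (add y (opp x)) <-> ale x y.
Proof.
  split; intros E.
  - apply (ale_add _ _ x) in E.
    replace x with (add zero x) by vec.
    replace y with (add (add y (opp x)) x) by vec. exact E.
  - apply (ale_add _ _ (opp x)) in E.
    replace zero with (add x (opp x)) by vec. exact E.
Qed.

Lemma add_ge0 x y : ale zero x -> ale zero y -> ale zero (add x y).
Proof.
  intros E1 E2. apply (ale_trans y); [exact E2|].
  apply (ale_add _ _ y) in E1. replace y with (add zero y) at 1 by vec. exact E1.
Qed.

Lemma ale_add2 x y u v : ale x y -> ale u v -> ale (add x u) (add y v).
Proof.
  intros E1%ale_sub E2%ale_sub. apply ale_sub.
  replace (add (add y v) (opp (add x u)))
    with (add (add y (opp x)) (add v (opp u))) by vec.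
  apply add_ge0; assumption.
Qed.

Lemma smul_ge0 a x : 0 <= a -> ale zero x -> ale zero (smul a x).
Proof.
  intros Ha E. rewrite <- (smul0r a). apply ale_smul; assumption.
Qed.

Lemma ale_opp x y : ale x y -> ale (opp y) (opp x).
Proof.
  intros E%ale_sub. apply ale_sub.
  replace (add (opp x) (opp (opp y))) with (add y (opp x)) by vec. exact E.
Qed.

Lemma ale_smul_l a b x : a <= b -> ale zero x -> ale (smul a x) (smul b x).
Proof.
  intros Hab E. apply ale_sub.
  replace (add (smul b x) (opp (smul a x))) with (smul (b - a) x) by vec.
  apply smul_ge0; [lra|exact E].
Qed.

(** Negation reverses the order, so the negative of the right-hand join is a lower bound of [x] and
    [y]. *)
Lemma opp_meet_le x y : ale (opp (meet x y)) (join (opp x) (opp y)).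
Proof.
  replace (join (opp x) (opp y)) with (opp (opp (join (opp x) (opp y)))) by vec.
  apply ale_opp. apply meet_glb.
  - replace x with (opp (opp x)) at 2 by vec. apply ale_opp, join_l.
  - replace y with (opp (opp y)) at 2 by vec. apply ale_opp, join_r.
Qed.

(** * Positive parts and disjointness *)

Definition pos x : G := join x zero.

Lemma pos_ge0 x : ale zero (pos x).
Proof. apply join_r. Qed.

Lemma ale_pos x : ale x (pos x).
Proof. apply join_l. Qed.

Lemma pos_id x : ale zero x -> pos x = x.
Proof. unfold pos. rewrite ale_join, joinC. auto. Qed.

Lemma pos_lub x y : ale x y -> ale zero y -> ale (pos x) y.
Proof. apply join_lub. Qed.

Lemma pos_eq0 x : pos x = zero -> ale x zero.
Proof. intros <-. apply ale_pos. Qed.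

(** [nonpos_on p f] says that f <= 0 on the support of p. *)
Definition nonpos_on p f : Prop := meet p (pos f) = zero.

Lemma nonpos_on_intro p f :
  ale zero p -> ale (meet p (pos f)) zero -> nonpos_on p f.
Proof.
  intros Hp E. apply ale_anti; [exact E|].
  apply meet_glb; [exact Hp|apply pos_ge0].
Qed.

(** Disjointness from [p] is stable under sums: with z = p /\ h^+, the difference z - g^+ lies below
    both p and f^+, hence below 0, so z <= p /\ g^+ = 0. *)
Lemma nonpos_on_add_pos p f g h : ale zero p -> nonpos_on p f -> nonpos_on p g ->
  ale h (add (pos f) (pos g)) -> nonpos_on p h.
Proof.
  intros Hp Hf Hg Hh. apply nonpos_on_intro; [exact Hp|].
  set (z := meet p (pos h)).
  assert (Hzp : ale z p) by apply meet_l.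
  assert (Hz : ale z (add (pos f) (pos g))).
  { apply (ale_trans (pos h)); [apply meet_r|].
    apply pos_lub; [exact Hh|]. apply add_ge0; apply pos_ge0. }
  assert (Hzg : ale z (pos g)).
  { assert (E : ale (add z (opp (pos g))) zero).
    { rewrite <- Hf. apply meet_glb.
      - apply (ale_trans z); [|exact Hzp]. apply ale_sub.
        replace (add z (opp (add z (opp (pos g))))) with (pos g) by vec.
        apply pos_ge0.
      - apply ale_sub. apply ale_sub in Hz.
        replace (add (pos f) (opp (add z (opp (pos g)))))
          with (add (add (pos f) (pos g)) (opp z)) by vec. exact Hz. }
    apply ale_sub. apply ale_sub in E.
    replace (add (pos g) (opp z)) with (add zero (opp (add z (opp (pos g))))) by vec.
    exact E. }
  rewrite <- Hg. apply meet_glb; assumption.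
Qed.

Lemma nonpos_on_le p q f g : ale zero q -> ale q p -> ale g f ->
  nonpos_on p f -> nonpos_on q g.
Proof.
  intros Hq Hqp Hgf Hf. apply nonpos_on_intro; [exact Hq|].
  rewrite <- Hf. apply meet_glb.
  - apply (ale_trans q); [apply meet_l|exact Hqp].
  - apply (ale_trans (pos g)); [apply meet_r|].
    apply pos_lub; [|apply pos_ge0]. apply (ale_trans f); [exact Hgf|apply ale_pos].
Qed.

Lemma nonpos_on_add p f g : ale zero p -> nonpos_on p f -> nonpos_on p g ->
  nonpos_on p (add f g).
Proof.
  intros Hp Hf Hg. apply (nonpos_on_add_pos p f g); auto.
  apply ale_add2; apply ale_pos.
Qed.

Lemma nonpos_on_join p f g : ale zero p -> nonpos_on p f -> nonpos_on p g ->
  nonpos_on p (join f g).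
Proof.
  intros Hp Hf Hg. apply (nonpos_on_add_pos p f g); auto.
  apply join_lub.
  - replace f with (add f zero) at 1 by vec.
    apply ale_add2; [apply ale_pos|apply pos_ge0].
  - replace g with (add zero g) at 1 by vec.
    apply ale_add2; [apply pos_ge0|apply ale_pos].
Qed.

(** For z = p /\ a w, the multiple z/(a+1) lies below both p and w, hence below 0. Dividing by a + 1
    instead of a covers a = 0 and keeps the factor at most 1. *)
Lemma disjoint_smul a p w : 0 <= a -> ale zero p -> ale zero w ->
  meet p w = zero -> ale (meet p (smul a w)) zero.
Proof.
  intros Ha Hp Hw E. set (z := meet p (smul a w)).
  assert (Hz : ale zero z).
  { apply meet_glb; [exact Hp|]. apply smul_ge0; assumption. }
  assert (Hc : 0 < / (a + 1)) by (apply Rinv_0_lt_compat; lra).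
  assert (Hc1 : / (a + 1) <= 1).
  { rewrite <- Rinv_1. apply Rinv_le_contravar; lra. }
  assert (Hca : / (a + 1) * (a + 1) = 1) by (field; lra).
  assert (E' : ale (smul (/ (a + 1)) z) zero).
  { rewrite <- E. apply meet_glb.
    - apply (ale_trans z); [|apply meet_l].
      rewrite <- (smul1 z) at 2. apply ale_smul_l; assumption.
    - apply (ale_trans (smul (/ (a + 1)) (smul a w))).
      + apply ale_smul; [lra|apply meet_r].
      + rewrite smulA. rewrite <- (smul1 w) at 2.
        apply ale_smul_l; [nra|exact Hw]. }
  apply (ale_smul (a + 1)) in E'; [|lra].
  rewrite smul0r, smulA, Rmult_comm, Hca, smul1 in E'. exact E'.
Qed.

Lemma nonpos_on_smul a p f : 0 <= a -> ale zero p -> nonpos_on p f ->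
  nonpos_on p (smul a f).
Proof.
  intros Ha Hp Hf. apply nonpos_on_intro; [exact Hp|].
  apply (ale_trans (meet p (smul a (pos f)))).
  - apply meet_glb; [apply meet_l|].
    apply (ale_trans (pos (smul a f))); [apply meet_r|].
    apply pos_lub.
    + apply ale_smul; [exact Ha|apply ale_pos].
    + apply smul_ge0; [exact Ha|apply pos_ge0].
  - apply disjoint_smul; auto. apply pos_ge0.
Qed.

Lemma nonpos_on_smul_l a p f : 0 <= a -> ale zero p -> nonpos_on p f ->
  nonpos_on (smul a p) f.
Proof.
  intros Ha Hp Hf. apply nonpos_on_intro.
  - apply smul_ge0; assumption.
  - rewrite meetC. apply disjoint_smul; auto; [apply pos_ge0|].
    rewrite meetC. exact Hf.
Qed.

Lemma nonpos_on0 p : ale zero p -> nonpos_on p zero.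
Proof.
  intros Hp. apply nonpos_on_intro; [exact Hp|].
  apply (ale_trans (pos zero)); [apply meet_r|].
  apply pos_lub; apply ale_refl.
Qed.

(** Let z be the meet. Since z <= w^- <= w^+ - w, the element w^+ - z still dominates both w and 0,
    hence w^+, and so z <= 0. *)
Lemma pos_opp_disjoint w : meet (pos w) (pos (opp w)) = zero.
Proof.
  apply (nonpos_on_intro (pos w) (opp w)); [apply pos_ge0|].
  set (z := meet _ _).
  assert (E : ale (pos w) (add (pos w) (opp z))).
  { apply pos_lub; apply ale_sub.
    - assert (Hz : ale z (add (pos w) (opp w))).
      { apply (ale_trans (pos (opp w))); [apply meet_r|].
        apply pos_lub.
        - apply ale_sub.
          replace (add (add (pos w) (opp w)) (opp (opp w))) with (pos w) by vec.
          apply pos_ge0.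
        - apply ale_sub, ale_pos. }
      apply ale_sub in Hz.
      replace (add (add (pos w) (opp z)) (opp w))
        with (add (add (pos w) (opp w)) (opp z)) by vec. exact Hz.
    - apply meet_l. }
  apply ale_sub. apply ale_sub in E.
  replace (add zero (opp z)) with (add (add (pos w) (opp z)) (opp (pos w))) by vec.
  exact E.
Qed.

(** Used to strengthen [p] so that the sign of [w] is decided: the part of [p] below w^+ is disjoint
    from w^-. *)
Lemma nonpos_on_restrict p w : ale zero p -> nonpos_on (meet p (pos w)) (opp w).
Proof.
  intros Hp. apply (nonpos_on_le (pos w) _ (opp w)).
  - apply meet_glb; [exact Hp|apply pos_ge0].
  - apply meet_r.
  - apply ale_refl.
  - apply pos_opp_disjoint.
Qed.

(** This turns a bound on a support back into an inequality in [G]: for z = p /\ u, the difference z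
    - v lies below p because v >= 0, and below (u - v)^+, hence below 0. *)
Lemma nonpos_on_meet_le p u v : ale zero p -> ale zero v ->
  nonpos_on p (add u (opp v)) -> ale (meet p u) v.
Proof.
  intros Hp Hv E. set (z := meet p u).
  assert (E' : ale (add z (opp v)) zero).
  { rewrite <- E. apply meet_glb.
    - apply (ale_trans z); [|apply meet_l]. apply ale_sub.
      replace (add z (opp (add z (opp v)))) with v by vec. exact Hv.
    - apply (ale_trans (add u (opp v))); [|apply ale_pos].
      apply ale_add2; [apply meet_r|apply ale_refl]. }
  apply ale_sub. apply ale_sub in E'.
  replace (add v (opp z)) with (add zero (opp (add z (opp v)))) by vec. exact E'.
Qed.

End Riesz.

(** * Countable suprema, the weak unit and bounds on supports *)

Section Sigma.

Context {G : sig_alg} {HS : is_sRSu G}.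
Implicit Types (p q u v w x y z f g h : G) (a b c s t : R) (F : nat -> G).

Local Instance sRSu_riesz : is_riesz G := proj1 HS.

Lemma bigv_ub g F n : ale (meet (F n) g) (bigv g F).
Proof.
  revert F. induction n as [|n IH]; intros F;
    destruct HS as (_ & _ & A2 & _); rewrite A2.
  - apply join_l.
  - apply (ale_trans (bigv g (fun k => F (S k)))); [|apply join_r].
    apply (IH (fun k => F (S k))).
Qed.

(** By (A1) the terms may be taken as F n /\ g; the assumption makes a further meet with [h]
    harmless, and (A3) applies. *)
Lemma bigv_lub g h F : (forall n, ale (meet (F n) g) h) -> ale (bigv g F) h.
Proof.
  destruct HS as (_ & A1 & _ & A3 & _). intros E.
  rewrite A1.
  replace (fun k => meet (F k) g) with (fun k => meet (meet (F k) g) h); [apply A3|].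
  apply functional_extensionality. intros k. apply E.
Qed.

(** A positive [p] equals its absolute value, so the last axiom presents it as the supremum of the p
    /\ n1. *)
Lemma unit_lub p h : ale zero p ->
  (forall n, ale (meet p (smul (INR (S n)) one)) h) -> ale p h.
Proof.
  destruct HS as (_ & _ & _ & _ & A4). intros Hp E.
  assert (Habs : aabs p = p).
  { unfold aabs. rewrite joinC. apply ale_join.
    apply (ale_trans zero); [|exact Hp].
    replace zero with (opp zero : G) by vec. apply ale_opp, Hp. }
  specialize (A4 p). rewrite Habs in A4. rewrite <- A4.
  apply bigv_lub. intros n. apply (ale_trans (meet p (smul (INR (S n)) one))); [|apply E].
  apply meet_l.
Qed.

(** If z = sup (n p), then also z - p is an upper bound. *)
Lemma archimedean p h : ale zero p ->
  (forall n, ale (smul (INR (S n)) p) h) -> ale p zero.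
Proof.
  intros Hp E.
  set (z := bigv h (fun n => smul (INR (S n)) p)).
  assert (Hz : forall n, ale (smul (INR (S n)) p) z).
  { intros n. pose proof (bigv_ub h (fun n => smul (INR (S n)) p) n) as Hn.
    cbv beta in Hn. rewrite (E n) in Hn. exact Hn. }
  assert (Hzp : ale z (add z (opp p))).
  { apply bigv_lub. intros n. apply (ale_trans (smul (INR (S n)) p)); [apply meet_l|].
    specialize (Hz (S n)). rewrite S_INR in Hz. apply ale_sub. apply ale_sub in Hz.
    replace (add (add z (opp p)) (opp (smul (INR (S n)) p)))
      with (add z (opp (smul (INR (S n) + 1) p))) by vec. exact Hz. }
  apply ale_sub in Hzp. apply ale_sub.
  replace (add zero (opp p)) with (add (add z (opp p)) (opp z)) by vec. exact Hzp.
Qed.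

(** The element v = 1^- is disjoint from 1^+, hence from the positive part of every n1. So v /\ n1
    <= 0 for all n, and the unit axiom gives v <= 0. *)
Lemma one_ge0 : ale zero (one : G).
Proof.
  set (v := pos (opp one : G)).
  assert (Hv : ale zero v) by apply pos_ge0.
  assert (Hv0 : ale v zero).
  { apply unit_lub; [exact Hv|]. intros n.
    assert (E : nonpos_on v one).
    { unfold nonpos_on. rewrite meetC. apply pos_opp_disjoint. }
    apply (nonpos_on_smul (INR (S n))) in E; [|apply pos_INR|exact Hv].
    rewrite <- E. apply meet_glb; [apply meet_l|].
    apply (ale_trans (smul (INR (S n)) one)); [apply meet_r|apply ale_pos]. }
  assert (E : ale (opp one) (zero : G)).
  { apply (ale_trans v); [apply ale_pos|exact Hv0]. }
  apply ale_sub in E. replace (one : G) with (add zero (opp (opp one)) : G) by vec.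
  exact E.
Qed.

Lemma nonpos_on_one p : ale zero p -> nonpos_on p one -> p = zero.
Proof.
  intros Hp E. apply ale_anti; [|exact Hp].
  apply unit_lub; [exact Hp|]. intros n.
  apply (nonpos_on_smul (INR (S n))) in E; [|apply pos_INR|exact Hp].
  rewrite <- E. apply meet_glb; [apply meet_l|].
  apply (ale_trans (smul (INR (S n)) one)); [apply meet_r|apply ale_pos].
Qed.

(** [le_on p f t] says that f <= t 1 on the support of p. *)
Definition le_on p f t : Prop := nonpos_on p (add f (smul (- t) one)).

Lemma le_on_weaken p q f g s t : ale zero q -> ale q p -> ale g f -> s <= t ->
  le_on p f s -> le_on q g t.
Proof.
  intros Hq Hqp Hgf Hst. apply nonpos_on_le; [exact Hq|exact Hqp|].
  apply ale_add2; [exact Hgf|]. apply ale_smul_l; [lra|apply one_ge0].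
Qed.

Lemma le_on_add p f g s t : ale zero p -> le_on p f s -> le_on p g t ->
  le_on p (add f g) (s + t).
Proof.
  intros Hp Hf Hg. unfold le_on.
  replace (add (add f g) (smul (- (s + t)) one))
    with (add (add f (smul (- s) one)) (add g (smul (- t) one))) by vec.
  apply nonpos_on_add; assumption.
Qed.

Lemma le_on_join p f g t : ale zero p -> le_on p f t -> le_on p g t ->
  le_on p (join f g) t.
Proof.
  intros Hp Hf Hg. unfold le_on.
  apply (nonpos_on_le p p (join (add f (smul (- t) one)) (add g (smul (- t) one))));
    [exact Hp|apply ale_refl| |apply nonpos_on_join; assumption].
  set (w := join (add f _) _).
  replace w with (add (add w (smul t one)) (smul (- t) one)) by vec.
  apply ale_add.
  assert (Hc : forall h, ale (add h (smul (- t) one)) w -> ale h (add w (smul t one))).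
  { intros h E. apply (ale_add _ _ (smul t one)) in E.
    replace h with (add (add h (smul (- t) one)) (smul t one)) by vec. exact E. }
  apply join_lub; apply Hc; [apply join_l|apply join_r].
Qed.

Lemma le_on_smul a p f t : 0 <= a -> ale zero p -> le_on p f t ->
  le_on p (smul a f) (a * t).
Proof.
  intros Ha Hp Hf. unfold le_on.
  replace (add (smul a f) (smul (- (a * t)) one))
    with (smul a (add f (smul (- t) one))) by vec.
  apply nonpos_on_smul; assumption.
Qed.

Lemma le_on_one p t : ale zero p -> le_on p (smul t one) t.
Proof.
  intros Hp. unfold le_on.
  replace (add (smul t one) (smul (- t) one)) with (zero : G) by vec.
  apply nonpos_on0, Hp.
Qed.

(** Consistency of forcing: for t < 0 the positive factor -1/t turns 0 - t1 into 1, and nothing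
    nonzero is disjoint from the weak unit. *)
Lemma le_on_zero_inv p t : ale zero p -> p <> zero -> le_on p zero t -> 0 <= t.
Proof.
  intros Hp Hp0 E. destruct (Rle_or_lt 0 t) as [Ht|Ht]; [exact Ht|].
  exfalso. apply Hp0, nonpos_on_one; [exact Hp|].
  assert (Ht' : 0 <= - / t) by (apply Rlt_le, Ropp_0_gt_lt_contravar, Rinv_lt_0_compat, Ht).
  apply (nonpos_on_smul (- / t)) in E; [|exact Ht'|exact Hp].
  replace (one : G) with (smul (- / t) (add zero (smul (- t) one)) : G); [exact E|].
  vec. field. lra.
Qed.

Lemma le_on_restrict p f t : ale zero p ->
  le_on (meet p (pos (add f (smul (- t) one)))) (opp f) (- t).
Proof.
  intros Hp. unfold le_on.
  replace (add (opp f) (smul (- - t) one)) with (opp (add f (smul (- t) one))) by vec.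
  apply nonpos_on_restrict, Hp.
Qed.

(** * Nonzero positive elements as forcing conditions, smaller ones being stronger, and dense
    sets *)

Definition cond p : Prop := ale zero p /\ p <> zero.

Definition dense (D : G -> Prop) : Prop :=
  forall p, cond p -> exists q, cond q /\ ale q p /\ D q.

Lemma le_on_sub p q f t : cond q -> ale q p -> le_on p f t -> le_on q f t.
Proof.
  intros [Hq _] Hqp. apply le_on_weaken; [exact Hq|exact Hqp|apply ale_refl|lra].
Qed.

Lemma le_on_raise p f s t : cond p -> s <= t -> le_on p f s -> le_on p f t.
Proof.
  intros [Hp _] Hst. apply le_on_weaken; [exact Hp|apply ale_refl|apply ale_refl|exact Hst].
Qed.

(** Failure of the first alternative says exactly that p /\ (f - t1)^+ is nonzero, and this element
    is the stronger condition. *)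
Lemma le_on_or_ge p f t : cond p ->
  le_on p f t \/ exists q, cond q /\ ale q p /\ le_on q (opp f) (- t).
Proof.
  intros [Hp Hp0].
  destruct (classic (le_on p f t)) as [E|E]; [left; exact E|right].
  exists (meet p (pos (add f (smul (- t) one)))). repeat split.
  - apply meet_glb; [exact Hp|apply pos_ge0].
  - exact E.
  - apply meet_l.
  - apply le_on_restrict, Hp.
Qed.

(** If [p] forced f >= n for every n >= 1, then mp /\ n1 <= f^+ for all m and n, so mp <= f^+ by the
    unit axiom and p = 0 by the Archimedean property. Hence some lower bound n fails, and a stronger
    condition forces f <= n. *)
Lemma dense_bounded f : dense (fun q => exists t, le_on q f t).
Proof.
  intros p [Hp Hp0].
  destruct (classic (forall n, le_on p (opp f) (- INR (S n)))) as [E|E].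
  - exfalso. apply Hp0, ale_anti; [|exact Hp].
    apply (archimedean p (pos f)); [exact Hp|]. intros m.
    assert (Hm : ale zero (smul (INR (S m)) p)) by (apply smul_ge0; [apply pos_INR|exact Hp]).
    apply unit_lub; [exact Hm|]. intros n.
    apply nonpos_on_meet_le; [exact Hm|apply pos_ge0|].
    apply nonpos_on_smul_l; [apply pos_INR|exact Hp|].
    apply (nonpos_on_le p p (add (opp f) (smul (- - INR (S n)) one)));
      [exact Hp|apply ale_refl| |apply E].
    rewrite (addC (opp f)), Ropp_involutive. apply ale_add2; [apply ale_refl|].
    apply ale_opp, ale_pos.
  - apply not_all_ex_not in E. destruct E as [n E].
    destruct (le_on_or_ge p (opp f) (- INR (S n)) (conj Hp Hp0)) as [E'|(q & Hq & Hqp & Hq')];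
      [contradiction|].
    exists q. split; [exact Hq|split; [exact Hqp|]]. exists (INR (S n)).
    replace (opp (opp f)) with f in Hq' by vec. rewrite Ropp_involutive in Hq'. exact Hq'.
Qed.

Definition near_on p f e : Prop := exists r, le_on p f (r + e) /\ le_on p (opp f) (- r + e).

(** Starting from bounds on f, walk up a grid of step e until f <= c + e is
    forced. *)
Lemma dense_near f e : 0 < e -> dense (fun q => near_on q f e).
Proof.
  intros He p Hp.
  destruct (dense_bounded f p Hp) as (p1 & Hp1 & Hp1p & b & Hb).
  destruct (dense_bounded (opp f) p1 Hp1) as (p2 & Hp2 & Hp2p & a & Ha).
  assert (Hb2 : le_on p2 f b).
  { apply (le_on_sub p1); assumption. }
  (* [n] steps of size [e] lead from the lower bound -a up to at least the upper bound b. *)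
  destruct (INR_unbounded ((b + a) / e)) as [n Hn].
  assert (Hbn : b <= - a + INR n * e).
  { apply (Rmult_lt_compat_r e) in Hn; [|exact He].
    unfold Rdiv in Hn. rewrite Rmult_assoc, Rinv_l in Hn by lra. lra. }
  assert (Hloop : forall n p c, cond p -> le_on p f (c + INR n * e) -> le_on p (opp f) (- c) ->
    exists q, cond q /\ ale q p /\ near_on q f e).
  { clear - HS He. intros n; induction n as [|n IH]; intros p c Hp Hu Hl.
    - exists p. split; [exact Hp|split; [apply ale_refl|]]. exists c. simpl in Hu.
      split; [apply (le_on_raise p f (c + 0 * e))|apply (le_on_raise p (opp f) (- c))];
        try assumption; lra.
    - destruct (le_on_or_ge p f (c + e) Hp) as [E|(q & Hq & Hqp & E)].
      + exists p. split; [exact Hp|split; [apply ale_refl|]]. exists c. split; [exact E|].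
        apply (le_on_raise p (opp f) (- c)); try assumption; lra.
      + destruct (IH q (c + e)) as (q' & Hq' & Hqq' & E').
        * exact Hq.
        * rewrite S_INR in Hu.
          apply (le_on_raise q f (c + (INR n + 1) * e)); [exact Hq|lra|].
          apply (le_on_sub p); assumption.
        * exact E.
        * exists q'. split; [exact Hq'|split; [|exact E']]. apply (ale_trans q); assumption. }
  destruct (Hloop n p2 (- a)) as (q & Hq & Hqp & E).
  - exact Hp2.
  - apply (le_on_raise p2 f b); assumption.
  - rewrite Ropp_involutive. exact Ha.
  - exists q. split; [exact Hq|split; [|exact E]].
    apply (ale_trans p2); [exact Hqp|]. apply (ale_trans p1); assumption.
Qed.

(** Otherwise [p] forces every F n /\ g to stay at least e below the supremum. Subtracting z = p /\
    e1 from the supremum then still leaves an upper bound, so z <= 0, and [p] is disjoint from the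
    unit. *)
Lemma dense_sup g F e : 0 < e ->
  dense (fun q => exists n, le_on q (add (bigv g F) (opp (meet (F n) g))) e).
Proof.
  intros He p Hp.
  destruct (classic (exists n q, cond q /\ ale q p /\
    le_on q (add (bigv g F) (opp (meet (F n) g))) e)) as [(n & q & Hq & Hqp & E)|E].
  - exists q. split; [exact Hq|split; [exact Hqp|exists n; exact E]].
  - exfalso. apply (proj2 Hp), nonpos_on_one; [apply Hp|].
    set (z := meet p (smul e one)).
    assert (Hz : ale zero z).
    { apply meet_glb; [apply Hp|]. apply smul_ge0; [lra|apply one_ge0]. }
    assert (Hzn : forall n, ale z (add (bigv g F) (opp (meet (F n) g)))).
    { intros n. apply nonpos_on_meet_le; [apply Hp| |].
      - apply (proj2 (ale_sub _ _)), bigv_ub.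
      - destruct (le_on_or_ge p (opp (add (bigv g F) (opp (meet (F n) g)))) (- e) Hp)
          as [E'|(q & Hq & Hqp & E')].
        + unfold le_on in E'. rewrite Ropp_involutive, addC in E'. exact E'.
        + exfalso. apply E. exists n, q. split; [exact Hq|split; [exact Hqp|]].
          rewrite Ropp_involutive in E'.
          set (k := add (bigv g F) _) in *.
          replace (opp (opp k)) with k in E' by vec. exact E'. }
    assert (Hzs : ale (bigv g F) (add (bigv g F) (opp z))).
    { apply bigv_lub. intros n. specialize (Hzn n). apply ale_sub. apply ale_sub in Hzn.
      set (m := meet (F n) g) in *.
      replace (add (add (bigv g F) (opp z)) (opp m))
        with (add (add (bigv g F) (opp m)) (opp z)) by vec. exact Hzn. }
    assert (Hz0 : ale z zero).
    { apply ale_sub in Hzs. apply ale_sub.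
      replace (add zero (opp z)) with (add (add (bigv g F) (opp z)) (opp (bigv g F))) by vec.
      exact Hzs. }
    assert (He1 : nonpos_on p (smul e one)).
    { unfold nonpos_on. rewrite pos_id; [|apply smul_ge0; [lra|apply one_ge0]].
      apply ale_anti; assumption. }
    apply (nonpos_on_smul (/ e)) in He1; [|apply Rlt_le, Rinv_0_lt_compat, He|apply Hp].
    replace (one : G) with (smul (/ e) (smul e one) : G); [exact He1|].
    vec. field. lra.
Qed.

(** For w = x - y, some (w - 1/n)^+ is nonzero and serves as the condition, with d = 1/n. Otherwise
    n w^+ <= 1 for all n, and the Archimedean property gives w <= 0. *)
Lemma exists_cond_gap x y : ~ ale x y ->
  exists p d, cond p /\ 0 < d /\ le_on p (add y (opp x)) (- d).
Proof.
  intros Hxy. set (w := add x (opp y)).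
  destruct (classic (exists n, pos (add w (smul (- / INR (S n)) one)) <> zero))
    as [[n E]|E].
  - set (u := pos _) in E. exists u, (/ INR (S n)). split; [|split].
    + split; [apply pos_ge0|exact E].
    + apply Rinv_0_lt_compat, lt_0_INR. lia.
    + assert (Hu : ale zero u) by apply pos_ge0.
      pose proof (le_on_restrict u w (/ INR (S n)) Hu) as Hr.
      (* Here [u] is the very positive part used for restricting, so restricting [u] returns [u]. *)
      fold u in Hr. rewrite meetxx in Hr.
      replace (add y (opp x)) with (opp w) by (unfold w; vec). exact Hr.
  - exfalso. apply Hxy. apply ale_sub.
    assert (Hw : ale (pos w) zero).
    { apply (archimedean _ one); [apply pos_ge0|]. intros n.
      assert (Hn : 0 < INR (S n)) by (apply lt_0_INR; lia).
      assert (E' : ale (pos w) (smul (/ INR (S n)) one)).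
      { apply pos_lub.
        - apply ale_sub.
          assert (Hn0 : pos (add w (smul (- / INR (S n)) one)) = zero).
          { apply NNPP. intros Hne. apply E. exists n. exact Hne. }
          apply pos_eq0, ale_sub in Hn0.
          replace (add (smul (/ INR (S n)) one) (opp w))
            with (add zero (opp (add w (smul (- / INR (S n)) one)))) by vec. exact Hn0.
        - apply smul_ge0; [apply Rlt_le, Rinv_0_lt_compat, Hn|apply one_ge0]. }
      apply (ale_smul (INR (S n))) in E'; [|lra].
      replace (one : G) with (smul (INR (S n)) (smul (/ INR (S n)) one) : G); [exact E'|].
      vec. field. lra. }
    assert (Hw' : ale w zero) by (apply (ale_trans (pos w)); [apply ale_pos|exact Hw]).
    apply ale_sub in Hw'.
    replace (add y (opp x)) with (add zero (opp w)) by (unfold w; vec). exact Hw'.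
Qed.

Lemma generic_sequence (D : nat -> G -> Prop) p : cond p -> (forall n, dense (D n)) ->
  exists P : nat -> G, P 0%nat = p /\
    forall n, cond (P n) /\ ale (P (S n)) (P n) /\ D n (P (S n)).
Proof.
  intros Hp HD.
  (* The relation is made total, with [q] itself as default at non-conditions, so that choice yields
     a step function on all of [G]. *)
  assert (Hstep : forall n q, exists q', cond q -> cond q' /\ ale q' q /\ D n q').
  { intros n q. destruct (classic (cond q)) as [Hq|Hq]; [|exists q; tauto].
    destruct (HD n q Hq) as [q' E]. exists q'. auto. }
  set (step n q := proj1_sig (constructive_indefinite_description _ (Hstep n q))).
  assert (Hs : forall n q, cond q -> cond (step n q) /\ ale (step n q) q /\ D n (step n q)).
  { intros n q. exact (proj2_sig (constructive_indefinite_description _ (Hstep n q))). }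
  set (P := fix P n := match n with O => p | S n => step n (P n) end).
  assert (HP : forall n, cond (P n)).
  { intros n; induction n as [|n IH]; [exact Hp|]. apply (Hs n), IH. }
  exists P. split; [reflexivity|]. intros n. split; [apply HP|]. apply (Hs n), HP.
Qed.

End Sigma.

(** * Suprema in the reals, and real values along a decreasing sequence of conditions *)

Lemma R_bigv_lub (g : R) (F : nat -> R) :
  is_lub (fun x => exists k : nat, x = Rmin (F k) g) (R_bigv g F).
Proof. exact (proj2_sig (completeness _ (R_sup_bound g F) (R_sup_ne g F))). Qed.

Lemma R_bigv_ext (g g' : R) (F F' : nat -> R) : g = g' -> (forall k, F k = F' k) ->
  R_bigv g F = R_bigv g' F'.
Proof.
  intros <- E. f_equal. apply functional_extensionality, E.
Qed.

Section Values.

Context {G : sig_alg} {HS : is_sRSu G}.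
Local Existing Instance sRSu_riesz.
Context (P : nat -> G) (HP : forall n, cond (P n)) (HPdec : forall n, ale (P (S n)) (P n)).
Implicit Types (x y f g : G) (a r s t e : R) (F : nat -> G).

Lemma decreasing_le m n : (m <= n)%nat -> ale (P n) (P m).
Proof.
  induction 1 as [|n _ IH]; [apply ale_refl|].
  apply (ale_trans (P n)); [apply HPdec|exact IH].
Qed.

Definition ev_le f t : Prop := exists k, le_on (P k) f t.

Lemma ev_le_common f g s t : ev_le f s -> ev_le g t ->
  exists k, le_on (P k) f s /\ le_on (P k) g t.
Proof.
  intros [k Hk] [l Hl]. exists (Nat.max k l). split.
  - apply (le_on_sub (P k)); [apply HP|apply decreasing_le; lia|exact Hk].
  - apply (le_on_sub (P l)); [apply HP|apply decreasing_le; lia|exact Hl].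
Qed.

Lemma ev_le_weaken f g s t : ale g f -> s <= t -> ev_le f s -> ev_le g t.
Proof.
  intros Hgf Hst [k Hk]. exists k.
  apply (le_on_weaken (P k) (P k) f g s t); auto; [apply HP|apply ale_refl].
Qed.

Lemma ev_le_add f g s t : ev_le f s -> ev_le g t -> ev_le (add f g) (s + t).
Proof.
  intros Hf Hg. destruct (ev_le_common f g s t Hf Hg) as (k & H1 & H2).
  exists k. apply le_on_add; [apply HP|exact H1|exact H2].
Qed.

Lemma ev_le_join f g t : ev_le f t -> ev_le g t -> ev_le (join f g) t.
Proof.
  intros Hf Hg. destruct (ev_le_common f g t t Hf Hg) as (k & H1 & H2).
  exists k. apply le_on_join; [apply HP|exact H1|exact H2].
Qed.

Lemma ev_le_smul a f t : 0 <= a -> ev_le f t -> ev_le (smul a f) (a * t).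
Proof.
  intros Ha [k Hk]. exists k. apply le_on_smul; [exact Ha|apply HP|exact Hk].
Qed.

Lemma ev_le_zero_inv t : ev_le zero t -> 0 <= t.
Proof.
  intros [k Hk]. apply (le_on_zero_inv (P k)); [apply HP|apply HP|exact Hk].
Qed.

Lemma ev_le_consistent f s t : ev_le f t -> ev_le (opp f) s -> 0 <= t + s.
Proof.
  intros Hf Hg. apply ev_le_zero_inv.
  replace zero with (add f (opp f)) by vec. apply ev_le_add; assumption.
Qed.

(** A relation and not a function, since the sequence need not decide every element of [G]. *)
Definition has_value f r : Prop :=
  forall e, 0 < e -> ev_le f (r + e) /\ ev_le (opp f) (- r + e).

Lemma has_value_unique f r s : has_value f r -> has_value f s -> r = s.
Proof.
  intros Hr Hs.
  assert (E : forall e, 0 < e -> r <= s + e /\ s <= r + e).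
  { intros e He.
    destruct (Hr (e / 2)) as [Hr1 Hr2]; [lra|]. destruct (Hs (e / 2)) as [Hs1 Hs2]; [lra|].
    pose proof (ev_le_consistent _ _ _ Hr1 Hs2). pose proof (ev_le_consistent _ _ _ Hs1 Hr2).
    lra. }
  apply Rle_antisym; apply le_epsilon; intros e He; apply E, He.
Qed.

Lemma has_value_one_multiple t : has_value (smul t one) t.
Proof.
  intros e He. split.
  - apply (ev_le_weaken (smul t one) _ t); [apply ale_refl|lra|].
    exists 0%nat. apply le_on_one, HP.
  - apply (ev_le_weaken (smul (- t) one) _ (- t)); [|lra|].
    + replace (opp (smul t one)) with (smul (- t) one : G) by vec. apply ale_refl.
    + exists 0%nat. apply le_on_one, HP.
Qed.

Lemma has_value_zero : has_value zero 0.
Proof.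
  replace zero with (smul 0 one : G) by vec. apply has_value_one_multiple.
Qed.

Lemma has_value_one : has_value one 1.
Proof.
  rewrite <- (smul1 one). apply has_value_one_multiple.
Qed.

Lemma has_value_add f g r s : has_value f r -> has_value g s -> has_value (add f g) (r + s).
Proof.
  intros Hf Hg e He.
  destruct (Hf (e / 2)) as [Hf1 Hf2]; [lra|]. destruct (Hg (e / 2)) as [Hg1 Hg2]; [lra|].
  split.
  - replace (r + s + e) with (r + e / 2 + (s + e / 2)) by field. apply ev_le_add; assumption.
  - replace (- (r + s) + e) with (- r + e / 2 + (- s + e / 2)) by field.
    replace (opp (add f g)) with (add (opp f) (opp g)) by vec. apply ev_le_add; assumption.
Qed.

Lemma has_value_opp f r : has_value f r -> has_value (opp f) (- r).
Proof.
  intros Hf e He. destruct (Hf e He) as [H1 H2]. split; [exact H2|].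
  replace (opp (opp f)) with f by vec. rewrite Ropp_involutive. exact H1.
Qed.

Lemma has_value_join f g r s : has_value f r -> has_value g s -> has_value (join f g) (Rmax r s).
Proof.
  intros Hf Hg e He. destruct (Hf e He) as [Hf1 Hf2]. destruct (Hg e He) as [Hg1 Hg2].
  pose proof (Rmax_l r s). pose proof (Rmax_r r s).
  split.
  - apply ev_le_join.
    + apply (ev_le_weaken f f (r + e)); [apply ale_refl|lra|exact Hf1].
    + apply (ev_le_weaken g g (s + e)); [apply ale_refl|lra|exact Hg1].
  - unfold Rmax. destruct (Rle_dec r s).
    + apply (ev_le_weaken (opp g) _ (- s + e)); [apply ale_opp, join_r|lra|exact Hg2].
    + apply (ev_le_weaken (opp f) _ (- r + e)); [apply ale_opp, join_l|lra|exact Hf2].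
Qed.

Lemma has_value_meet f g r s : has_value f r -> has_value g s -> has_value (meet f g) (Rmin r s).
Proof.
  intros Hf Hg.
  assert (E : meet f g = opp (join (opp f) (opp g))).
  { apply ale_anti.
    - replace (meet f g) with (opp (opp (meet f g))) by vec. apply ale_opp.
      apply join_lub; apply ale_opp; [apply meet_l|apply meet_r].
    - replace (meet f g) with (opp (opp (meet f g))) by vec. apply ale_opp, opp_meet_le. }
  rewrite E. replace (Rmin r s) with (- Rmax (- r) (- s)).
  - apply has_value_opp, has_value_join; apply has_value_opp; assumption.
  - unfold Rmax, Rmin. destruct (Rle_dec (- r) (- s)), (Rle_dec r s); lra.
Qed.

Lemma has_value_smul a f r : has_value f r -> has_value (smul a f) (a * r).
Proof.
  assert (Hpos : forall a f r, 0 <= a -> has_value f r -> has_value (smul a f) (a * r)).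
  { clear a f r. intros a f r Ha Hf e He.
    (* The denominator a + 1 also covers a = 0. *)
    assert (Hd : 0 < e / (a + 1)) by (apply Rdiv_lt_0_compat; lra).
    assert (Had : a * (e / (a + 1)) <= e).
    { assert (Hda : (a + 1) * (e / (a + 1)) = e) by (field; lra). nra. }
    destruct (Hf _ Hd) as [H1 H2]. split.
    - apply (ev_le_weaken (smul a f) _ (a * (r + e / (a + 1)))); [apply ale_refl|lra|].
      apply ev_le_smul; assumption.
    - apply (ev_le_weaken (smul a (opp f)) _ (a * (- r + e / (a + 1)))); [|lra|].
      + replace (opp (smul a f)) with (smul a (opp f)) by vec. apply ale_refl.
      + apply ev_le_smul; assumption. }
  intros Hf. destruct (Rle_or_lt 0 a) as [Ha|Ha]; [apply Hpos; assumption|].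
  replace (smul a f) with (smul (- a) (opp f)) by vec.
  replace (a * r) with (- a * - r) by ring.
  apply Hpos; [lra|apply has_value_opp, Hf].
Qed.

(** The lower bound comes from a term whose value is within e/2 of the real supremum. The upper
    bound needs the approximate attainment: the supremum in [G] is a term F n /\ g plus a remainder
    eventually at most e/2. *)
Lemma has_value_bigv g F s (r : nat -> R) : has_value g s ->
  (forall n, has_value (F n) (r n)) ->
  (forall e, 0 < e -> exists n, ev_le (add (bigv g F) (opp (meet (F n) g))) e) ->
  has_value (bigv g F) (R_bigv s r).
Proof.
  intros Hg HF Happrox.
  assert (Hm : forall n, has_value (meet (F n) g) (Rmin (r n) s)).
  { intros n. apply has_value_meet; [apply HF|exact Hg]. }
  destruct (R_bigv_lub s r) as [Hub Hlub].
  set (b := R_bigv s r) in *.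
  intros e He. split.
  - destruct (Happrox (e / 2)) as [n Hn]; [lra|].
    destruct (Hm n (e / 2)) as [H1 _]; [lra|].
    assert (Hb : Rmin (r n) s <= b) by (apply Hub; exists n; reflexivity).
    apply (ev_le_weaken (add (add (bigv g F) (opp (meet (F n) g))) (meet (F n) g)) _
      (e / 2 + (Rmin (r n) s + e / 2))); [|lra|apply ev_le_add; assumption].
    set (m := meet (F n) g).
    replace (add (add (bigv g F) (opp m)) m) with (bigv g F) by vec. apply ale_refl.
  - destruct (classic (exists n, b - e / 2 < Rmin (r n) s)) as [[n Hn]|Hn].
    + destruct (Hm n (e / 2)) as [_ H2]; [lra|].
      apply (ev_le_weaken (opp (meet (F n) g)) _ (- Rmin (r n) s + e / 2));
        [apply ale_opp, bigv_ub|lra|exact H2].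
    + exfalso. assert (b <= b - e / 2); [|lra].
      apply Hlub. intros x [n ->]. apply Rnot_lt_le. intros Hx. apply Hn. exists n. exact Hx.
Qed.

(** The value is the supremum of the t for which f >= t is eventually forced; consistency bounds
    this set above. *)
Lemma has_value_exists f : (forall m, exists k, near_on (P k) f (/ INR (S m))) ->
  exists r, has_value f r.
Proof.
  intros Hnear.
  destruct (completeness (fun t => ev_le (opp f) (- t))) as [b [Hub Hlub]].
  - destruct (Hnear 0%nat) as (k & r & H1 & _). exists (r + / INR 1).
    intros x Hx. assert (0 <= r + / INR 1 + - x); [|lra].
    apply (ev_le_consistent f); [exists k; exact H1|exact Hx].
  - destruct (Hnear 0%nat) as (k & r & _ & H2). exists (r - / INR 1).
    exists k. replace (- (r - / INR 1)) with (- r + / INR 1) by ring. exact H2.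
  - exists b. intros e He.
    (* The supremum is within 1/(m+1) of the centre r given by [near_on], whose own error is
       1/(m+1); hence the factor 2. *)
    destruct (INR_unbounded (2 / e)) as [m Hm].
    assert (Hm0 : 0 < INR (S m)) by (apply lt_0_INR; lia).
    assert (Hme : 2 * / INR (S m) <= e).
    { rewrite S_INR in *. apply (Rmult_lt_compat_r e) in Hm; [|exact He].
      unfold Rdiv in Hm. rewrite Rmult_assoc, Rinv_l in Hm by lra.
      apply (Rmult_le_reg_r (INR m + 1)); [exact Hm0|].
      rewrite Rmult_assoc, Rinv_l by lra. nra. }
    destruct (Hnear m) as (k & r & H1 & H2).
    assert (Hrb : r - / INR (S m) <= b).
    { apply Hub. exists k. replace (- (r - / INR (S m))) with (- r + / INR (S m)) by ring.
      exact H2. }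
    assert (Hbr : b <= r + / INR (S m)).
    { apply Hlub. intros x Hx. assert (0 <= r + / INR (S m) + - x); [|lra].
      apply (ev_le_consistent f); [exists k; exact H1|exact Hx]. }
    split.
    + apply (ev_le_weaken f f (r + / INR (S m))); [apply ale_refl|lra|exists k; exact H1].
    + apply (ev_le_weaken (opp f) (opp f) (- r + / INR (S m)));
        [apply ale_refl|lra|exists k; exact H2].
Qed.

End Values.

(** * Homomorphism equations and the congruence they generate *)

Section Instances.

Context {G : sig_alg}.

(** [IOp args] stands for the equation v (op args) = op (v args). *)
Inductive instance :=
  | IZero | IOne
  | IAdd (x y : G) | IOpp (x : G) | IMeet (x y : G) | IJoin (x y : G)
  | ISmul (a : R) (x : G) | IBigv (g : G) (F : nat -> G).

Definition respects (v : G -> R) (c : instance) : Prop :=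
  match c with
  | IZero => v zero = 0
  | IOne => v one = 1
  | IAdd x y => v (add x y) = v x + v y
  | IOpp x => v (opp x) = - v x
  | IMeet x y => v (meet x y) = Rmin (v x) (v y)
  | IJoin x y => v (join x y) = Rmax (v x) (v y)
  | ISmul a x => v (smul a x) = a * v x
  | IBigv g F => v (bigv g F) = R_bigv (v g) (fun k => v (F k))
  end.

(** The arguments and the result of an operation, listed as a sequence to accommodate [IBigv]; the
    finitary lists are padded by repeating the result. *)
Definition involved (c : instance) (j : nat) : G :=
  match c, j with
  | IZero, _ => zero
  | IOne, _ => one
  | IAdd x y, 0%nat => x | IAdd x y, 1%nat => y | IAdd x y, _ => add x y
  | IOpp x, 0%nat => x | IOpp x, _ => opp x
  | IMeet x y, 0%nat => x | IMeet x y, 1%nat => y | IMeet x y, _ => meet x y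
  | IJoin x y, 0%nat => x | IJoin x y, 1%nat => y | IJoin x y, _ => join x y
  | ISmul a x, 0%nat => x | ISmul a x, _ => smul a x
  | IBigv g F, 0%nat => g | IBigv g F, 1%nat => bigv g F | IBigv g F, S (S k) => F k
  end.

(** Solution sets of countably many equations play the role of sets of full measure. *)
Definition ae_eq (u w : Rpow (G -> R)) : Prop :=
  exists C : nat -> instance, forall v, (forall n, respects v (C n)) -> u v = w v.

Lemma ae_eq_pointwise u w : (forall v, u v = w v) -> ae_eq u w.
Proof. intros E. exists (fun _ => IZero). auto. Qed.

Lemma ae_eq_instance c u w : (forall v, respects v c -> u v = w v) -> ae_eq u w.
Proof. intros E. exists (fun _ => c). intros v Hv. exact (E v (Hv 0%nat)). Qed.

(** A countable union of countable sets of equations is countable, by choice and Cantor pairing.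
    This is what makes the congruence compatible with the infinitary operation. *)
Lemma ae_eq_countable (U W : nat -> Rpow (G -> R)) (u w : Rpow (G -> R)) :
  (forall n, ae_eq (U n) (W n)) ->
  (forall v, (forall n, U n v = W n v) -> u v = w v) -> ae_eq u w.
Proof.
  intros HUW E.
  set (C n := proj1_sig (constructive_indefinite_description _ (HUW n))).
  exists (fun n => let (i, j) := of_nat n in C i j).
  intros v Hv. apply E. intros i.
  apply (proj2_sig (constructive_indefinite_description _ (HUW i))).
  intros j. specialize (Hv (to_nat (i, j))). rewrite cancel_of_to in Hv. exact Hv.
Qed.

Lemma ae_eq_binary (u1 w1 u2 w2 u w : Rpow (G -> R)) : ae_eq u1 w1 -> ae_eq u2 w2 ->
  (forall v, u1 v = w1 v -> u2 v = w2 v -> u v = w v) -> ae_eq u w.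
Proof.
  intros H1 H2 E.
  apply (ae_eq_countable (fun n => match n with O => u1 | _ => u2 end)
                         (fun n => match n with O => w1 | _ => w2 end)).
  - intros [|n]; assumption.
  - intros v Hv. apply E; [apply (Hv 0%nat)|apply (Hv 1%nat)].
Qed.

Lemma ae_eq_unary (u1 w1 u w : Rpow (G -> R)) : ae_eq u1 w1 ->
  (forall v, u1 v = w1 v -> u v = w v) -> ae_eq u w.
Proof. intros H1 E. apply (ae_eq_binary u1 w1 u1 w1); auto. Qed.

Lemma ae_eq_congruence : is_congruence (Rpow (G -> R)) ae_eq.
Proof.
  repeat split.
  - intros x. apply ae_eq_pointwise. reflexivity.
  - intros x y H. apply (ae_eq_unary _ _ _ _ H). auto.
  - intros x y z H1 H2. apply (ae_eq_binary _ _ _ _ _ _ H1 H2). intros v; congruence.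
  - intros x x' y y' H1 H2. apply (ae_eq_binary _ _ _ _ _ _ H1 H2). simpl; congruence.
  - intros x x' H. apply (ae_eq_unary _ _ _ _ H). simpl; congruence.
  - intros x x' y y' H1 H2. apply (ae_eq_binary _ _ _ _ _ _ H1 H2). simpl; congruence.
  - intros x x' y y' H1 H2. apply (ae_eq_binary _ _ _ _ _ _ H1 H2). simpl; congruence.
  - intros a x x' H. apply (ae_eq_unary _ _ _ _ H). simpl; congruence.
  - intros g g' F F' Hg HF.
    apply (ae_eq_countable (fun n => match n with O => g | S k => F k end)
                           (fun n => match n with O => g' | S k => F' k end)).
    + intros [|k]; [exact Hg|apply HF].
    + intros v Hv. simpl. apply R_bigv_ext; [apply (Hv 0%nat)|].
      intros k. apply (Hv (S k)).
Qed.

End Instances.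

Arguments instance : clear implicits.

(** * Separation by a generic sequence *)

Section Separation.

Context {G : sig_alg} {HS : is_sRSu G}.
Local Existing Instance sRSu_riesz.

(** Approximate attainment is needed only for suprema: the finitary equations
    already follow from the additivity and monotonicity of forcing. *)
Definition sup_attained (c : instance G) (e : R) (q : G) : Prop :=
  match c with
  | IBigv g F => exists n, le_on q (add (bigv g F) (opp (meet (F n) g))) e
  | _ => True
  end.

Lemma dense_sup_attained c e : 0 < e -> dense (sup_attained c e).
Proof.
  intros He. destruct c;
    try (intros p Hp; exists p; split; [exact Hp|split; [apply ale_refl|exact I]]).
  apply dense_sup, He.
Qed.

Lemma exists_respecting_lt (C : nat -> instance G) (x y : G) : ~ ale x y ->
  exists v, (forall n, respects v (C n)) /\ v y < v x.
Proof.
  intros Hxy. destruct (exists_cond_gap x y Hxy) as (p & d & Hp & Hd & Hgap).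
  (* Adding an instance that involves x and y makes their values decided. *)
  set (C' n := match n with O => IAdd x y | S k => C k end).
  (* The index codes a triple: equation i, element j involved in it, precision 1/(m+1). *)
  set (D n q := let (i, jm) := of_nat n in let (j, m) := of_nat jm in
    sup_attained (C' i) (/ INR (S m)) q /\ near_on q (involved (C' i) j) (/ INR (S m))).
  assert (HD : forall n, dense (D n)).
  { intros n q Hq. unfold D. destruct (of_nat n) as [i jm], (of_nat jm) as [j m].
    assert (He : 0 < / INR (S m)) by (apply Rinv_0_lt_compat, lt_0_INR; lia).
    destruct (dense_near (involved (C' i) j) _ He q Hq) as (q1 & Hq1 & Hq1q & (r & Hr1 & Hr2)).
    destruct (dense_sup_attained (C' i) _ He q1 Hq1) as (q2 & Hq2 & Hq2q & E).
    exists q2. split; [exact Hq2|split; [|split; [exact E|]]].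
    - apply (ale_trans q1); assumption.
    - exists r. split; apply (le_on_sub q1); assumption. }
  destruct (generic_sequence D p Hp HD) as (P & HP0 & HPn).
  assert (HP : forall n, cond (P n)) by apply HPn.
  assert (HPdec : forall n, ale (P (S n)) (P n)) by apply HPn.
  assert (HDij : forall i j m, exists k, sup_attained (C' i) (/ INR (S m)) (P k) /\
    near_on (P k) (involved (C' i) j) (/ INR (S m))).
  { intros i j m. exists (S (to_nat (i, to_nat (j, m)))).
    destruct (HPn (to_nat (i, to_nat (j, m)))) as (_ & _ & E).
    unfold D in E. rewrite !cancel_of_to in E. exact E. }
  (* An arbitrary real where [f] has no value; only the involved elements matter. *)
  set (v f := epsilon (inhabits 0) (has_value P f)).
  assert (Hv : forall i j, has_value P (involved (C' i) j) (v (involved (C' i) j))).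
  { intros i j. apply epsilon_spec. apply has_value_exists; [exact HP|exact HPdec|].
    intros m. destruct (HDij i j m) as (k & _ & E). exists k. exact E. }
  exists v. split.
  - intros n.
    (* Each equation holds because both of its sides are values of the same element. The index
       shifts by one since [C'] has an extra equation in front. *)
    pose proof (has_value_unique P HP HPdec) as Huniq.
    pose proof (Hv (S n)) as Hn. pose proof (HDij (S n)) as HDn.
    change (C' (S n)) with (C n) in Hn, HDn.
    destruct (C n) as [| |a b|a|a b|a b|a b|g F]; simpl in *.
    + apply (Huniq _ _ _ (Hn 0%nat)), has_value_zero; assumption.
    + apply (Huniq _ _ _ (Hn 0%nat)), has_value_one; assumption.
    + apply (Huniq _ _ _ (Hn 2%nat)), has_value_add; try assumption;
        [apply (Hn 0%nat)|apply (Hn 1%nat)].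
    + apply (Huniq _ _ _ (Hn 1%nat)), has_value_opp; try assumption. apply (Hn 0%nat).
    + apply (Huniq _ _ _ (Hn 2%nat)), has_value_meet; try assumption;
        [apply (Hn 0%nat)|apply (Hn 1%nat)].
    + apply (Huniq _ _ _ (Hn 2%nat)), has_value_join; try assumption;
        [apply (Hn 0%nat)|apply (Hn 1%nat)].
    + apply (Huniq _ _ _ (Hn 1%nat)), has_value_smul; try assumption. apply (Hn 0%nat).
    + apply (Huniq _ _ _ (Hn 1%nat)), has_value_bigv; try assumption.
      * apply (Hn 0%nat).
      * intros k. apply (Hn (S (S k))).
      * intros e He. destruct (archimed_cor1 e He) as (m & Hm & Hm0).
        destruct m as [|m]; [lia|].
        destruct (HDn 0%nat m) as (k & (l & E) & _). exists l, k.
        apply (le_on_raise (P k) _ (/ INR (S m))); [apply HP|lra|exact E].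
  - pose proof (Hv 0%nat 0%nat) as Hx. pose proof (Hv 0%nat 1%nat) as Hy. simpl in Hx, Hy.
    pose proof (has_value_add P HP HPdec _ _ _ _ Hx (has_value_opp P _ _ Hy)) as Hxy'.
    destruct (Hxy' (d / 2)) as [H1 _]; [lra|].
    assert (H2 : ev_le P (opp (add x (opp y))) (- d)).
    { exists 0%nat. rewrite HP0. replace (opp (add x (opp y))) with (add y (opp x)) by vec.
      exact Hgap. }
    pose proof (ev_le_consistent P HP HPdec _ _ _ H1 H2). lra.
Qed.

End Separation.

(** * The embedding by evaluation *)

Theorem mainTheorem15 :
  forall G : sig_alg, is_sRSu G ->
  exists (I : Type) (th : Rpow I -> Rpow I -> Prop) (phi : G -> Rpow I),
    is_congruence (Rpow I) th /\ embeds_into_quotient G (Rpow I) th phi.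
Proof.
  intros G HS.
  exists (G -> R), ae_eq, (fun x v => v x). split; [apply ae_eq_congruence|].
  repeat split.
  - apply (ae_eq_instance IZero). auto.
  - apply (ae_eq_instance IOne). auto.
  - intros x y. apply (ae_eq_instance (IAdd x y)). auto.
  - intros x. apply (ae_eq_instance (IOpp x)). auto.
  - intros x y. apply (ae_eq_instance (IMeet x y)). auto.
  - intros x y. apply (ae_eq_instance (IJoin x y)). auto.
  - intros a x. apply (ae_eq_instance (ISmul a x)). auto.
  - intros g F. apply (ae_eq_instance (IBigv g F)). auto.
  - intros x y [C HC].
    (* The same countable set [C] serves both inequalities, and antisymmetry then gives equality. *)
    assert (Hle : forall a b : G,
      (forall v, (forall n, respects v (C n)) -> v a = v b) -> ale a b).
    { intros a b E. apply NNPP. intros Hab.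
      destruct (exists_respecting_lt (HS := HS) C a b Hab) as (v & Hv & Hlt).
      rewrite (E v Hv) in Hlt. lra. }
    apply (ale_anti (HG := proj1 HS)); apply Hle; [exact HC|].
    intros v Hv. symmetry. exact (HC v Hv).
Qed.
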